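(* Let $K$ be an algebraically closed field, let $R$ be a matrix factorization of $W\in K[x_1,\dots,x_n]$, and let $n$ be odd. Then $$\chi(\operatorname{End}(R))=0.$$
   Context: A matrix factorization of $W$ is a $\mathbb{Z}/2\mathbb{Z}$-graded free $K[x_1,\dots,x_n]$-module $R$ of finite rank with an odd $K[x_1,\dots,x_n]$-linear endomorphism $d_R$ satisfying $d_R^2=W\cdot \mathrm{id}_R$. Here $\operatorname{End}(R)$ denotes the cohomology of the endomorphism dg-ring of $R$ in the ($\mathbb{Z}/2\mathbb{Z}$-graded) dg-category of matrix factorizations of $W$: the cohomology of the $\mathbb{Z}/2\mathbb{Z}$-graded algebra of all $K[x_1,\dots,x_n]$-linear endomorphisms of $R$ with differential $f\mapsto d_R f-(-1)^{|f|}f d_R$. The setting is the one in which the Milnor ring $K[x_1,\dots,x_n]/(\partial_{x_1}W,\dots,\partial_{x_n}W)$ and $\operatorname{End}(R)$ are finite-dimensional over $K$, so that the Euler characteristic makes sense. For a $\mathbb{Z}/2\mathbb{Z}$-graded vector space $V=V_0\oplus V_1$, $\chi(V)=\dim V_0-\dim V_1$. *)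

(* Defs.v *)
From Stdlib Require Import ClassicalEpsilon.
From HB Require Import structures.
From mathcomp Require Import all_boot all_order all_algebra.
From mathcomp Require Import mpoly.

Set Implicit Arguments.
Unset Strict Implicit.
Unset Printing Implicit Defensive.

Import GRing.Theory.

Local Open Scope ring_scope.

(* The K-vector space Z / B, for K-subspaces B <= Z of a K[x_1, ..., x_n]-module
   V (on which c : K acts as the constant polynomial c%:MP), is handled through
   representatives: (e_i) is a basis of Z / B when the classes of the e_i
   generate Z / B and are linearly independent. *)
Section QuotientDimension.

Variables (n : nat) (K : fieldType) (V : lmodType {mpoly K[n]}).
Variables Z B : V -> Prop.

Definition klincomb (d : nat) (c : 'I_d -> K) (e : 'I_d -> V) : V :=
  \sum_(i < d) (c i)%:MP_[n] *: e i.

Definition quot_generating (d : nat) (e : 'I_d -> V) : Prop :=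
  forall z, Z z -> exists c : 'I_d -> K, B (z - klincomb c e).

Definition quot_independent (d : nat) (e : 'I_d -> V) : Prop :=
  forall c : 'I_d -> K, B (klincomb c e) -> forall i, c i = 0.

Definition quot_basis (d : nat) (e : 'I_d -> V) : Prop :=
  [/\ forall i, Z (e i), quot_generating e & quot_independent e].

Definition quot_has_dim (d : nat) : Prop :=
  exists e : 'I_d -> V, quot_basis e.

Definition quot_finite_dim : Prop := exists d, quot_has_dim d.

(* Unspecified when Z / B is infinite-dimensional. *)
Definition quot_dim : nat := epsilon (inhabits 0%N) quot_has_dim.

End QuotientDimension.

Section Milnor.

Variables (n : nat) (K : fieldType) (W : {mpoly K[n]}).

Definition jacobian_ideal (f : {mpoly K[n]}^o) : Prop :=
  exists g : 'I_n -> {mpoly K[n]}, f = \sum_(i < n) g i * mderiv i W.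

Definition milnor_finite_dim : Prop :=
  quot_finite_dim (fun _ : {mpoly K[n]}^o => True) jacobian_ideal.

End Milnor.

Section Grading.

Variables (S : comNzRingType) (R0 R1 : vectType S).

(* A vectType over a commutative ring is a free module of finite rank;
   R0 * R1 is the Z/2-graded module with even part R0 and odd part R1.
   Parity false is degree 0 and parity true is degree 1. *)
Definition graded_part (b : bool) (x : R0 * R1) : Prop :=
  if b then x.1 = 0 else x.2 = 0.

Definition homogeneous_of (e : bool) (f : 'End((R0 * R1)%type)) : Prop :=
  forall b x, graded_part b x -> graded_part (b (+) e) (f x).

End Grading.

Record matrix_factorization (n : nat) (K : fieldType) (W : {mpoly K[n]}) :=
  MatrixFactorization {
    mf_even : vectType {mpoly K[n]};
    mf_odd : vectType {mpoly K[n]};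
    mf_d : 'End((mf_even * mf_odd)%type);
    mf_d_odd : homogeneous_of true mf_d;
    mf_d_sqr : (mf_d \o mf_d)%VF = W *: \1%VF
  }.

Section Endomorphisms.

Variables (n : nat) (K : fieldType) (W : {mpoly K[n]}).
Variable R : matrix_factorization W.

Definition mf_module : vectType {mpoly K[n]} := (mf_even R * mf_odd R)%type.

Definition end_differential (e : bool) (f : 'End(mf_module)) :
    'End(mf_module) :=
  (mf_d R \o f)%VF - (-1) ^+ e *: (f \o mf_d R)%VF.

Definition end_cocycle (e : bool) (f : 'End(mf_module)) : Prop :=
  homogeneous_of e f /\ end_differential e f = 0.

Definition end_coboundary (e : bool) (f : 'End(mf_module)) : Prop :=
  exists2 g : 'End(mf_module),
    homogeneous_of (~~ e) g & f = end_differential (~~ e) g.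

Definition End_finite_dim : Prop :=
  forall e : bool, quot_finite_dim (end_cocycle e) (end_coboundary e).

Definition End_dim (e : bool) : nat :=
  quot_dim (end_cocycle e) (end_coboundary e).

Definition chi_End : int := (End_dim false)%:Z - (End_dim true)%:Z.

End Endomorphisms.

(* Main.v *)
(* The Hom complex of matrix factorizations is Calabi-Yau of dimension n, so for n
   odd dim H^0(End R) = dim H^1(End R); this is proved by showing that a
   Kapustin-Li type residue pairing H^e x H^(e+n) -> K is nondegenerate.

   Let S = K[x_1, ..., x_n]. As the Milnor ring is finite-dimensional, some monic
   univariate p has p(x_i) = sum_j g_ij dW/dx_j for every i. Differentiating
   d_R^2 = W shows that lambda_i := (multiplication by sum_j g_ij d(d_R)/dx_j) is a
   homotopy, d lambda_i + lambda_i d = p(x_i). Let res be the residue functional on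
   S/(p(x_1), ..., p(x_n)), whose associated bilinear form is nondegenerate. The
   pairing is <f, g> = res (str (f . lambda_1 ... lambda_n g)).

   Suppose that the cocycle f pairs to 0 with all cocycles. Using lambda_k one turns
   any w with dw in (p(x_k), ...)E into a cocycle modulo one generator fewer, up to a
   term lambda_k v; as p(x_i) is a regular sequence in any order, it follows that f
   is orthogonal to all cocycles of E/(p(x_1), ..., p(x_n))E. The latter being
   finite-dimensional and self-dual, f is a coboundary modulo (p(x_1), ..., p(x_n)),
   and removing the generators one at a time with the lambda_k again, f is a
   coboundary. *)

From Stdlib Require Import Classical ClassicalEpsilon.
Require Import Defs.
From HB Require Import structures.
From mathcomp Require Import all_boot all_order all_algebra.
From mathcomp Require Import ssrcomplements mpoly.

Set Implicit Arguments.
Unset Strict Implicit.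
Unset Printing Implicit Defensive.

Import Order.TTheory GRing.Theory.

Local Open Scope ring_scope.

(** * Submodules generated by part of a sequence of scalars *)

Section SequenceSubmodule.

Variables (S : comNzRingType) (n : nat) (p : 'I_n -> S).

(** The predicate [P] selects the generators in use, so that they can be discarded one at a time and
    in any order. *)
Definition seq_submod (P : pred 'I_n) (M : lmodType S) (m : M) : Prop :=
  exists G : 'I_n -> M, m = \sum_(i | P i) p i *: G i.

Variable M : lmodType S.
Implicit Types (P T : pred 'I_n) (m : M).

Lemma seq_submodD P m1 m2 :
  seq_submod P m1 -> seq_submod P m2 -> seq_submod P (m1 + m2).
Proof.
move=> [G1 ->] [G2 ->]; exists (fun i => G1 i + G2 i).
by rewrite -big_split; apply: eq_bigr => i _; rewrite scalerDr.
Qed.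

Lemma seq_submodZ P a m : seq_submod P m -> seq_submod P (a *: m).
Proof.
move=> [G ->]; exists (fun i => a *: G i).
by rewrite scaler_sumr; apply: eq_bigr => i _; rewrite !scalerA mulrC.
Qed.

Lemma seq_submodN P m : seq_submod P m -> seq_submod P (- m).
Proof. by rewrite -scaleN1r; apply: seq_submodZ. Qed.

Lemma seq_submod0 P : seq_submod P (0 : M).
Proof. by exists (fun=> 0); rewrite big1 // => i _; rewrite scaler0. Qed.

Lemma seq_submod_sum P (J : Type) (s : seq J) (C : pred J) (F : J -> M) :
  (forall j, C j -> seq_submod P (F j)) -> seq_submod P (\sum_(j <- s | C j) F j).
Proof.
move=> hF; apply: (big_ind (seq_submod P (M := M))) => //.
  exact: seq_submod0.
exact: seq_submodD.
Qed.

Lemma seq_submod_sub P T m :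
  (forall i, P i -> T i) -> seq_submod P m -> seq_submod T m.
Proof.
move=> sPT [G ->]; exists (fun i => if P i then G i else 0).
rewrite [RHS](bigID P) /= [X in _ + X]big1 => [|i /andP[_ /negPf ->]]; last first.
  by rewrite scaler0.
rewrite addr0; apply: eq_big => [i | i ->//].
by apply/idP/andP => [Pi | []//]; split=> //; apply: sPT.
Qed.

Lemma seq_submod_gen P k m : P k -> seq_submod P (p k *: m).
Proof.
move=> Pk; exists (fun i => if i == k then m else 0).
rewrite (bigD1 k) //= eqxx big1 ?addr0 // => i /andP[_ /negPf ->].
by rewrite scaler0.
Qed.

Lemma seq_submod_pred0 P m : (forall i, ~~ P i) -> seq_submod P m -> m = 0.
Proof.
by move=> P0 [G ->]; rewrite big1 // => i Pi; have := P0 i; rewrite Pi.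
Qed.

(** Isolates the contribution of one generator, which a homotopy can then absorb. *)
Lemma seq_submod_split P T k m :
    (forall i, T i -> (i == k) || P i) -> seq_submod T m ->
  exists v, seq_submod P (m - p k *: v).
Proof.
(* If [k] is not in [T] there is nothing to remove, and v = 0 works. *)
move=> sT [G ->]; exists (if T k then G k else 0).
have [Tk | nTk] := ifP.
  rewrite (bigD1 k) //= addrAC subrr add0r; apply: seq_submod_sum => i /andP[Ti nik].
  by apply: seq_submod_gen; have := sT _ Ti; rewrite (negPf nik).
rewrite scaler0 subr0; apply: seq_submod_sum => i Ti; apply: seq_submod_gen.
by have := sT _ Ti; case: eqP => // eik; rewrite eik nTk in Ti.
Qed.

Lemma seq_submod_linear (M' : lmodType S) (f : {linear M -> M'}) P m :
  seq_submod P m -> seq_submod P (f m).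
Proof.
move=> [G ->]; exists (fun i => f (G i)).
by rewrite linear_sum; apply: eq_bigr => i _; rewrite linearZ.
Qed.

End SequenceSubmodule.

(** * Duality for a differential module with homotopies for a regular sequence *)

Section Duality.

Variables (n : nat) (S : comNzRingType) (K : fieldType) (iota : K -> S).
Variable M : lmodType S.
Variables (p : 'I_n -> S) (d gam : {linear M -> M}) (lam : 'I_n -> {linear M -> M}).
Variables (B : M -> {linear M -> S^o}) (rho : {additive S -> K}).
Local Notation I := (seq_submod p).
Local Notation in_seq s := (fun i => i \in s).

(** The p_i are regular in every order, on M and on S. In the application M is a matrix algebra,
    [gam] its parity involution, [B] the supertrace form and [rho] the residue, so that [rho]
    composed with [B] is nondegenerate modulo all the p_i. *)
Hypothesis reg : forall P k m, ~~ P k -> I P (p k *: m) -> I P (m : M).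
Hypothesis regS : forall P k (s : S^o), ~~ P k -> I P (p k *: s) -> I P s.
Hypothesis dd : forall m, d (d m) = 0.
Hypothesis d_lam : forall i m, d (lam i m) + lam i (d m) = p i *: m.
Hypothesis gamK : forall m, gam (gam m) = m.
Hypothesis d_gam : forall m, d (gam m) = - gam (d m).
Hypothesis BDl : forall y a x x', B (a *: x + x') y = a * B x y + B x' y.
Hypothesis Bd : forall x y, B (d x) y = B (gam x) (d y).
Hypothesis rhoZ : forall a s, rho (iota a * s) = a * rho s.
Hypothesis rhoI : forall s : S^o, I xpredT s -> rho s = 0.
Hypothesis Bnondegl : forall m, (forall y, rho (B m y) = 0) -> I xpredT m.
Hypothesis Bnondegr : forall m, (forall y, rho (B y m) = 0) -> I xpredT m.
Variables (J : finType) (b : J -> M).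
Hypothesis b_span :
  forall m, exists c : J -> K, I xpredT (m - \sum_j iota (c j) *: b j).

Definition homotopies (s : seq 'I_n) (m : M) : M := foldr (fun i => lam i) m s.

Lemma homotopies_cat s t m : homotopies (s ++ t) m = homotopies s (homotopies t m).
Proof. exact: foldr_cat. Qed.

Lemma homotopies_linear s : linear (homotopies s).
Proof. by move=> a x y; elim: s => //= i s ->; rewrite linearP. Qed.

HB.instance Definition _ s :=
  GRing.isLinear.Build S M M _ (homotopies s) (homotopies_linear s).

(** Moving [d] past each [lam i] costs a sign and a multiple of p_i, so the composite commutes with
    [d] up to sign modulo the generators indexed by [s]. *)
Lemma d_homotopies s m :
  I (in_seq s) (d (homotopies s m) - (-1) ^+ size s *: homotopies s (d m)).
Proof.
elim: s => [|i s IH] /=; first by rewrite scale1r subrr; apply: seq_submod0.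
have -> : d (lam i (homotopies s m)) =
          p i *: homotopies s m - lam i (d (homotopies s m)).
  by rewrite -d_lam addrK.
rewrite exprS -scalerA scaleN1r opprK -addrA.
apply: seq_submodD.
  by apply: (@seq_submod_gen _ _ _ _ (in_seq _)); rewrite inE eqxx.
have -> : - lam i (d (homotopies s m)) +
    (-1) ^+ size s *: lam i (homotopies s (d m)) =
    - lam i (d (homotopies s m) - (-1) ^+ size s *: homotopies s (d m)).
  by rewrite linearB linearZ opprB addrC.
apply: seq_submodN; apply: seq_submod_linear; apply: seq_submod_sub IH => j js.
by rewrite inE js orbT.
Qed.

(** With the arguments swapped, linearity of [B] in its first variable can be registered as a linear
    structure. *)
Definition pairingl y x : S^o := B x y.
Lemma pairingl_linear y : linear (pairingl y).
Proof. by move=> a x x'; apply: BDl. Qed.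
HB.instance Definition _ y :=
  GRing.isLinear.Build S M S^o _ (pairingl y) (pairingl_linear y).

(* If f = dh + p_k e + ..., then de lies in the remaining ideal by regularity and
   p_k e = d (lam_k e) + lam_k (de), so that h + lam_k e uses one generator fewer. *)
Lemma exact_of_exact_mod f h s :
  uniq s -> d f = 0 -> I (in_seq s) (f - d h) -> exists g, f = d g.
Proof.
move=> us df0; elim: s us h => [_ h|k s IH /= /andP[nks us] h] Ifh.
  exists h; apply/eqP; rewrite -subr_eq0; apply/eqP.
  exact: seq_submod_pred0 Ifh.
have [|e Ie] := seq_submod_split (P := in_seq s) (k := k) _ Ifh.
  by move=> i; rewrite inE.
have Ide : I (in_seq s) (d e).
  apply: (@reg _ k) => //.
  have := seq_submod_linear d (seq_submodN Ie).
  by rewrite opprB linearB linearZ linearB df0 dd subrr subr0.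
apply: (IH us (h + lam k e)).
have -> : f - d (h + lam k e) = f - d h - p k *: e + lam k (d e).
  by rewrite -d_lam linearD !opprD !addrA addrNK.
by apply: seq_submodD => //; apply: seq_submod_linear.
Qed.

(** Modulo all the p_i this is finite-dimensional linear algebra over K: a functional that kills the
    image of [d] but not f is represented by some z, and self-adjointness of [d] up to [gam] makes
    dz orthogonal to everything, hence zero in the quotient. *)
Lemma separating_cocycle_mod f :
    (forall h, ~ I xpredT (f - d h)) ->
  exists2 z, I xpredT (d z) & rho (B f z) != 0.
Proof.
move=> nf; pose N := #|J|.
(* Modulo the ideal, m is determined by the values of its functional on the spanning family [b]. *)
pose phi m := \row_(u < N) rho (B m (b (enum_val u))).
pose A := \matrix_(t < N) phi (d (b (enum_val t))).
have rho_lin m (w : 'cV[K]_N) :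
    rho (B m (\sum_u iota (w u 0) *: b (enum_val u))) = (phi m *m w) 0 0.
  rewrite (linear_sum (B m)) raddf_sum mxE; apply: eq_bigr => u _.
  by rewrite linearZ /= rhoZ mxE mulrC.
have phi0 m : phi m = 0 -> I xpredT m.
  move=> pm0; apply: Bnondegl => y; have [c /(seq_submod_linear (B m))] := b_span y.
  rewrite linearB /= => /rhoI; rewrite raddfB => /eqP.
  rewrite subr_eq0 => /eqP ->; rewrite (linear_sum (B m)) raddf_sum big1 // => j _.
  rewrite linearZ /= rhoZ; have /rowP/(_ (enum_rank j)) := pm0.
  by rewrite !mxE enum_rankK => ->; rewrite mulr0.
have phiB m m' : phi (m - m') = phi m - phi m'.
  by apply/rowP => u; rewrite !mxE -![B _ _]/(pairingl _ _) linearB raddfB.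
have : ~~ (phi f <= A)%MS.
  apply/negP => /submxP[c fE].
  apply: (nf (\sum_t iota (c 0 t) *: b (enum_val t))); apply: phi0.
  rewrite phiB fE; apply/rowP => u; rewrite !mxE; apply/eqP; rewrite subr_eq0.
  apply/eqP; rewrite linear_sum /= -[B _ _]/(pairingl _ _) linear_sum raddf_sum.
  by apply: eq_bigr => t _; rewrite !mxE linearZ /= linearZ /= rhoZ.
rewrite submxE => nz.
have [u nzu] : exists u, (phi f *m cokermx A) 0 u != 0.
  apply/existsP; apply: contraNT nz; rewrite negb_exists => /forallP h.
  by apply/eqP/rowP => u; rewrite [RHS]mxE; apply/eqP; rewrite -[_ == _]negbK.
(* A column of [cokermx A] is a functional killing the rows of [A], that is all boundaries; this one
   does not kill [phi f]. *)
pose w := col u (cokermx A).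
exists (\sum_v iota (w v 0) *: b (enum_val v)); last first.
  suff wE : (phi f *m w) 0 0 = (phi f *m cokermx A) 0 u by rewrite rho_lin wE.
  by rewrite !mxE; apply: eq_bigr => v _; rewrite !mxE.
set z := \sum_v _; have z0 j : rho (B (d (b j)) z) = 0.
  suff wE : (phi (d (b j)) *m w) 0 0 = (A *m cokermx A) (enum_rank j) u.
    by rewrite rho_lin wE mulmx_coker mxE.
  by rewrite !mxE; apply: eq_bigr => v _; rewrite !mxE enum_rankK.
(* By adjointness B(y, dz) = B(d(gam y), z), which [z0] kills once gam y is expanded in the spanning
   family. *)
apply: Bnondegr => y; rewrite -[y]gamK -Bd; have [c] := b_span (gam y).
move/(seq_submod_linear d)/(seq_submod_linear (pairingl z))/rhoI.
rewrite !linearB raddfB => /eqP; rewrite subr_eq0 => /eqP ->.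
rewrite !linear_sum raddf_sum big1 // => j _.
by rewrite !linearZ /= rhoZ -/(pairingl _ _) z0 mulr0.
Qed.

(* With dw = p_k v modulo the other generators of u, w' := w - lam_k v is a cocycle
   modulo one generator fewer, and p_k B(f, nu w') = B(gam (lam_k f), d (nu w')) lies
   in the ideal of the p_i with i != k, hence so does B(f, nu w'). *)
Lemma cocycle_orthogonal_cocycle_mod f s u w :
    s ++ u = enum 'I_n -> d f = 0 ->
    (forall g, d g = 0 -> rho (B f (homotopies (enum 'I_n) g)) = 0) ->
    I (in_seq u) (d w) -> rho (B f (homotopies s w)) = 0.
Proof.
move=> + df0 fg0; elim: u s w => [|k u IH] s w sE Idw.
  move: sE; rewrite cats0 => ->; apply: fg0.
  exact: seq_submod_pred0 Idw.
have := enum_uniq 'I_n; rewrite -sE cat_uniq /= negb_or => /and3P[us].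
move=> /andP[ks hsu] /andP[ku uu].
have [|v Iv] := seq_submod_split (P := in_seq u) (k := k) _ Idw.
  by move=> i; rewrite inE.
have Idv : I (in_seq u) (d v).
  apply: (@reg _ k) => //.
  have := seq_submod_linear d (seq_submodN Iv).
  by rewrite opprB linearB linearZ dd subr0.
have [w' wE] : exists w', w = w' + lam k v by exists (w - lam k v); rewrite subrK.
rewrite [in homotopies s w]wE.
rewrite 2!linearD raddfD /= [X in _ + X](_ : _ = 0) ?addr0; last first.
  have -> : homotopies s (lam k v) = homotopies (s ++ [:: k]) v.
    by rewrite homotopies_cat.
  by apply: IH; rewrite // -catA.
have Idw' : I (in_seq u) (d w').
  have -> : d w' = d w - p k *: v + lam k (d v).
    by rewrite -d_lam wE linearD opprD !addrA addrNK addrK.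
  by apply: seq_submodD => //; apply: seq_submod_linear.
apply: rhoI; apply: (seq_submod_sub (P := fun i => i != k)) => //.
apply: (@regS _ k); first by rewrite negbK.
have pf : p k *: f = d (lam k f) by rewrite -d_lam df0 linear0 addr0.
suff: I (fun i => i != k) (pairingl (homotopies s w') (p k *: f)).
  by rewrite linearZ.
rewrite pf /pairingl Bd; apply: seq_submod_linear.
rewrite -[d _](subrK ((-1) ^+ size s *: homotopies s (d w'))).
apply: seq_submodD.
  apply: seq_submod_sub (d_homotopies s w') => i is_.
  by apply: contraNneq ks => <-.
apply: seq_submodZ; apply: seq_submod_linear; apply: seq_submod_sub Idw' => i iu.
by apply: contraNneq ku => <-.
Qed.

Theorem cocycle_pairing_nondegenerate f :
    d f = 0 ->
    (forall g, d g = 0 -> rho (B f (homotopies (enum 'I_n) g)) = 0) ->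
  exists h, f = d h.
Proof.
move=> df0 fg0.
have [[h Ih] | nf] := classic (exists h, I xpredT (f - d h)).
  apply: (exact_of_exact_mod (h := h) (enum_uniq 'I_n)) => //.
  by apply: seq_submod_sub Ih => i _; rewrite mem_enum.
have [|z Idz /eqP[]] := @separating_cocycle_mod f.
  by move=> h Ih; apply: nf; exists h.
(* With no homotopy applied yet and all generators remaining, orthogonality covers every z that is a
   cocycle modulo the whole ideal. *)
apply: (@cocycle_orthogonal_cocycle_mod f [::] (enum 'I_n)) => //.
by apply: seq_submod_sub Idz => i _; rewrite mem_enum.
Qed.

(** For a cocycle f, adjointness gives B(f, dx) = 0, and the homotopies carry dh to a boundary up to
    terms in the ideal, which [rho] kills. *)
Lemma cocycle_pairing_coboundary f h :
  d f = 0 -> rho (B f (homotopies (enum 'I_n) (d h))) = 0.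
Proof.
move=> df0; set s := enum _; pose e : S := (-1) ^+ size s.
have Bfd x : B f (d x) = 0.
  by rewrite -[f]gamK -Bd d_gam df0 linear0 oppr0 -[LHS]/(pairingl _ _) linear0.
have ee : e * e = 1 by rewrite -expr2 sqrr_sign.
have -> : homotopies s (d h) =
    - (e *: (d (homotopies s h) - e *: homotopies s (d h)) - d (e *: homotopies s h)).
  by rewrite scalerBr scalerA ee scale1r linearZ !opprB addrC subrK.
rewrite linearN raddfN; apply/eqP; rewrite oppr_eq0; apply/eqP.
rewrite linearB Bfd subr0; apply: rhoI; apply: seq_submod_linear.
apply: seq_submodZ; apply: seq_submod_sub (d_homotopies s h) => //.
Qed.

End Duality.

(** * Linear maps prescribed on monomials *)

Section MonomialExtension.

Variables (n : nat) (K : comNzRingType) (V : lmodType K).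

Definition monomial_ext (F : 'X_{1..n} -> V) (s : {mpoly K[n]}) : V :=
  \sum_(m <- msupp s) s@_m *: F m.

Lemma monomial_ext_bounded F s k : (msize s <= k)%N ->
  monomial_ext F s = \sum_(m : 'X_{1..n < k}) s@_m *: F m.
Proof.
move=> le_sk; rewrite /monomial_ext.
rewrite (big_mksub 'X_{1..n < k}) ?msupp_uniq //=; last first.
  by move=> m /msize_mdeg_lt /leq_trans; apply.
rewrite big_rmcond //= => m /memN_msupp_eq0 ->.
by rewrite scale0r.
Qed.

Lemma monomial_ext_linear F : linear (monomial_ext F).
Proof.
move=> a s t; pose k := maxn (msize (a *: s + t)) (maxn (msize s) (msize t)).
rewrite !(@monomial_ext_bounded _ _ k) /k ?leq_max ?leqnn ?orbT //.
rewrite scaler_sumr -big_split; apply: eq_bigr => m _.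
by rewrite mcoeffD mcoeffZ scalerDl scalerA.
Qed.

HB.instance Definition _ F :=
  GRing.isLinear.Build K {mpoly K[n]} V _ (monomial_ext F) (monomial_ext_linear F).

Lemma monomial_extX F m : monomial_ext F 'X_[m] = F m.
Proof. by rewrite /monomial_ext msuppX big_seq1 mcoeffX eqxx scale1r. Qed.

End MonomialExtension.

(** * Normal forms modulo the p(x_i), the residue functional and regularity *)

Section Reduction.

Variables (n : nat) (K : fieldType) (p : {poly K}) (d : nat).
Hypotheses (p_monic : p \is monic) (p_size : size p = d.+2).
Local Notation S := {mpoly K[n]}.

Let mscalerAl c (s t : S) : (c *: s) * t = c *: (s * t).
Proof. by rewrite scalerAl. Qed.
Let mscalerAr c (s t : S) : s * (c *: t) = c *: (s * t).
Proof. by rewrite scalerAr. Qed.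

Definition in_var (i : 'I_n) : {poly K} -> S := horner_alg ('X_i : S).
HB.instance Definition _ i := GRing.LRMorphism.copy (in_var i) (horner_alg ('X_i : S)).

Lemma in_varZ i a q : in_var i (a *: q) = a *: in_var i q.
Proof. by rewrite linearZ /= mulr_algl. Qed.

Lemma in_varX i : in_var i 'X = 'X_i.
Proof. exact: horner_algX. Qed.

Lemma in_varXn i k : in_var i 'X^k = 'X_[U_(i) *+ k].
Proof. by rewrite rmorphXn /= in_varX mpolyXn. Qed.

Lemma mpolyX_in_var m : 'X_[m] = \prod_i in_var i 'X^(m i).
Proof. by rewrite mpolyXE_id; apply: eq_bigr => i _; rewrite in_varXn mpolyXn. Qed.

Definition rem_if (b : bool) (q : {poly K}) := if b then q %% p else q.

Lemma rem_if_linear b : linear (rem_if b).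
Proof. by case: b => // a q r; rewrite /rem_if modpD modpZl. Qed.
HB.instance Definition _ b :=
  GRing.isLinear.Build K {poly K} {poly K} _ (rem_if b) (rem_if_linear b).

(** The generators p(x_i) involve separate variables, so dividing in each variable of [T]
    independently yields a normal form modulo these generators. *)
Definition reduceX (T : pred 'I_n) (m : 'X_{1..n}) : S :=
  \prod_i in_var i (rem_if (T i) 'X^(m i)).

Definition reduce T := monomial_ext (reduceX T).
HB.instance Definition _ T := GRing.Linear.copy (reduce T) (monomial_ext (reduceX T)).

Lemma reduceXE T m : reduce T 'X_[m] = reduceX T m.
Proof. exact: monomial_extX. Qed.

Lemma reduce_in_varM T k q m :
  reduce T (in_var k q * 'X_[m]) =
  in_var k (rem_if (T k) (q * 'X^(m k))) *
  \prod_(i | i != k) in_var i (rem_if (T i) 'X^(m i)).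
Proof.
rewrite -{1 2}[q]coefK poly_def linear_sum !mulr_suml !linear_sum mulr_suml.
apply: eq_bigr => j _; rewrite /= in_varZ mscalerAl -scalerAl.
rewrite [reduce _ _]linearZ [rem_if _ _]linearZ /=.
rewrite in_varZ mscalerAl; congr (_ *: _).
rewrite in_varXn -mpolyXD reduceXE /reduceX (bigD1 k) //= -exprD; congr (_ * _).
  by rewrite mnmDE mulmnE mnm1E eqxx mul1n.
apply: eq_bigr => i /negPf nik.
by rewrite mnmDE mulmnE mnm1E eq_sym nik mul0n add0n.
Qed.

Lemma reduce_in_var_out (T : pred 'I_n) k q s :
  ~~ T k -> reduce T (in_var k q * s) = in_var k q * reduce T s.
Proof.
move=> /negPf nTk; rewrite [s]mpolyE mulr_sumr !linear_sum mulr_sumr.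
apply: eq_bigr => m _; rewrite mscalerAr !linearZ /= mscalerAr; congr (_ *: _).
rewrite reduce_in_varM nTk /= rmorphM -mulrA; congr (_ * _).
by rewrite reduceXE /reduceX [RHS](bigD1 k) //= nTk.
Qed.

Lemma reduce_in_var_in (T : pred 'I_n) k s :
  T k -> reduce T (in_var k p * s) = 0.
Proof.
move=> Tk; rewrite [s]mpolyE mulr_sumr linear_sum big1 // => m _.
by rewrite mscalerAr linearZ /= reduce_in_varM Tk /= modp_mulr rmorph0 mul0r scaler0.
Qed.

Local Notation I := (seq_submod (fun i => in_var i p)).

Lemma in_var_rem_if T i q : I T (in_var i q - in_var i (rem_if (T i) q) : S^o).
Proof.
case Ti: (T i); last by rewrite /= subrr; apply: seq_submod0.
rewrite /= {1}[q](divp_eq q p) -rmorphB addrK rmorphM mulrC.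
exact: (@seq_submod_gen _ _ _ S^o).
Qed.

Lemma sub_reduce T (s : S) : I T (s - reduce T s : S^o).
Proof.
have -> : s - reduce T s = \sum_(m <- msupp s) (s@_m)%:MP * ('X_[m] - reduceX T m).
  rewrite [X in X - _]mpolyE /reduce /monomial_ext -sumrB.
  by apply: eq_bigr => m _; rewrite mul_mpolyC scalerBr.
apply: (@seq_submod_sum _ _ _ S^o) => m _; apply: (@seq_submodZ _ _ _ S^o).
rewrite mpolyX_in_var /reduceX.
(* Powers are exchanged for their remainders one factor at a time, and each exchange costs an
   element of the ideal. *)
apply: (big_rec2 (fun a b => I T (a - b : S^o))) => [|i a b _ Iab].
  by rewrite subrr; apply: seq_submod0.
set u := in_var _ _; set v := in_var _ _.
have -> : u * a - v * b = u * (a - b) + b * (u - v).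
  by rewrite !mulrBr addrA [b * u]mulrC addrNK [b * v]mulrC.
by apply: seq_submodD; apply: (@seq_submodZ _ _ _ S^o) => //; apply: in_var_rem_if.
Qed.

Lemma reduce_eq0P T s : reduce T s = 0 <-> I T (s : S^o).
Proof.
split=> [s0 | [G ->]]; first by rewrite -[s]subr0 -s0; apply: sub_reduce.
by rewrite linear_sum big1 // => i Ti; apply: reduce_in_var_in.
Qed.

Lemma prod_in_var N (q : 'I_n -> {poly K}) : (forall i, (size (q i) <= N)%N) ->
  \prod_i in_var i (q i) =
  \sum_(f : {ffun 'I_n -> 'I_N})
    (\prod_i (q i)`_(f i)) *: 'X_[[multinom f i : nat | i < n]].
Proof.
move=> qN.
transitivity (\prod_i \sum_(j < N) (q i)`_j *: ('X_[U_(i) *+ j] : S)).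
  apply: eq_bigr => i _; have qE : q i = \sum_(j < N) (q i)`_j *: 'X^j.
    rewrite -poly_def; apply/polyP => j; rewrite coef_poly; case: ltnP => // le_Nj.
    by rewrite nth_default // (leq_trans (qN i)).
  by rewrite {1}qE linear_sum; apply: eq_bigr => j _; rewrite /= in_varZ in_varXn.
rewrite bigA_distr_bigA; apply: eq_bigr => f _ /=.
rewrite scaler_prod [in RHS]mpolyXE_id; congr (_ *: _); apply: eq_bigr => i _.
by rewrite mnmE mpolyXn.
Qed.

(* p has degree d + 1 >= 1, so the monomials with all exponents <= d span the quotient. *)
Definition box (f : {ffun 'I_n -> 'I_d.+1}) : 'X_{1..n} := [multinom f i : nat | i < n].

Lemma box_inj : injective box.
Proof.
by move=> f g /mnmP fg; apply/ffunP => i; apply: val_inj; have := fg i; rewrite !mnmE.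
Qed.

Let p_neq0 : p != 0. Proof. exact: monic_neq0. Qed.

Lemma reduceX_box m :
  reduceX xpredT m =
  \sum_(f : {ffun 'I_n -> 'I_d.+1}) (\prod_i ('X^(m i) %% p)`_(f i)) *: 'X_[box f].
Proof.
by apply: prod_in_var => i; rewrite -ltnS -p_size ltn_modp.
Qed.

Lemma coef_reduceX_box m (f : {ffun 'I_n -> 'I_d.+1}) :
  (reduceX xpredT m)@_(box f) = \prod_i ('X^(m i) %% p)`_(f i).
Proof.
rewrite reduceX_box raddf_sum /= (bigD1 f) //= mcoeffZ mcoeffX eqxx mulr1.
rewrite [X in _ + X]big1 ?addr0 // => g ngf; rewrite mcoeffZ mcoeffX.
by rewrite (inj_eq box_inj) (negPf ngf) mulr0.
Qed.

Lemma reduce_box s :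
  reduce xpredT s = \sum_f (reduce xpredT s)@_(box f) *: 'X_[box f].
Proof.
rewrite {1 2}[s]mpolyE !linear_sum.
transitivity (\sum_(m <- msupp s) \sum_f
    (s@_m * (reduceX xpredT m)@_(box f)) *: ('X_[box f] : S)).
  apply: eq_bigr => m _; rewrite linearZ /= reduceXE {1}reduceX_box scaler_sumr.
  by apply: eq_bigr => f _; rewrite coef_reduceX_box scalerA.
rewrite exchange_big /=; apply: eq_bigr => f _; rewrite -scaler_suml; congr (_ *: _).
by rewrite raddf_sum; apply: eq_bigr => m _; rewrite linearZ /= reduceXE mcoeffZ.
Qed.

Lemma reduce_supp s m i : (reduce xpredT s)@_m != 0 -> (m i <= d)%N.
Proof.
move=> cm; have [/existsP[f /eqP ->] | /existsPn nf] := boolP [exists f, m == box f].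
  by rewrite mnmE -ltnS.
case/eqP: cm; rewrite reduce_box raddf_sum big1 // => f _.
by rewrite /= mcoeffZ mcoeffX eq_sym (negPf (nf f)) mulr0.
Qed.

(* The coefficient of (x_1 ... x_n)^d in the normal form of s modulo the p(x_i). *)
Definition residue (s : S) : K := (reduce xpredT s)@_(box [ffun=> ord_max]).

Lemma residue_linear : linear (residue : S -> K^o).
Proof. by move=> a s t; rewrite /residue linearP mcoeffD mcoeffZ. Qed.
HB.instance Definition _ :=
  GRing.isLinear.Build K S K^o _ residue residue_linear.

Lemma residueZ a s : residue (a *: s) = a * residue s.
Proof. by rewrite /residue linearZ mcoeffZ. Qed.

Lemma residueX m : residue 'X_[m] = \prod_i ('X^(m i) %% p)`_d.
Proof.
by rewrite /residue reduceXE coef_reduceX_box; apply: eq_bigr => i _; rewrite ffunE.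
Qed.

Lemma residue_mem s : I xpredT (s : S^o) -> residue s = 0.
Proof. by rewrite /residue => /reduce_eq0P ->; rewrite mcoeff0. Qed.

Lemma rem_Xn k : (k <= d)%N -> 'X^k %% p = 'X^k.
Proof. by move=> le_kd; rewrite modp_small // size_polyXn p_size !ltnS. Qed.

Lemma residue_nondegenerate a :
  (forall y, residue (a * y) = 0) -> I xpredT (a : S^o).
Proof.
move=> a0; apply/reduce_eq0P/eqP; set b := reduce _ a; apply: contraT => b_neq0.
(* Testing against the complement of the leading monomial x^m isolates its
   coefficient: another monomial of b is smaller than x^m in some variable. *)
pose m := mlead b; pose y : S := 'X_[[multinom (d - m i)%N | i < n]].
have md i : (m i <= d)%N.
  by apply: (@reduce_supp a); rewrite -mcoeff_msupp; apply: mlead_supp.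
have : residue (b * y) = 0.
  rewrite -(a0 y) /b; apply/eqP; rewrite eq_sym -subr_eq0 -raddfB -mulrBl mulrC.
  by apply/eqP/residue_mem; apply: (@seq_submodZ _ _ _ S^o); apply: sub_reduce.
rewrite [b]mpolyE mulr_suml linear_sum (bigD1_seq m) ?msupp_uniq ?mlead_supp //=.
rewrite [X in _ + X]big1_seq ?addr0.
  move/eqP; rewrite mscalerAl linearZ /= -mpolyXD residueX mulf_eq0 => /orP[].
    by rewrite mleadc_eq0 (negPf b_neq0).
  rewrite big1 ?oner_eq0 // => i _; rewrite mnmDE mnmE subnKC // rem_Xn //.
  by rewrite coefXn eqxx.
move=> m' /andP[nm' m'b]; rewrite mscalerAl linearZ /= -mpolyXD residueX.
(* Otherwise x^m divides x^m', and since the monomial order is graded, the leading monomial has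
   maximal degree, forcing m' = m. *)
have [i lt_i] : exists i, (m' i < m i)%N.
  apply/existsP; apply: contraT => /existsPn le_m.
  have m'E : m' = (m + (m' - m))%MM.
    by apply/mnmP => i; rewrite mnmDE mnmBE subnKC // leqNgt le_m.
  have := lemc_mdeg (msupp_le_mlead m'b); rewrite {1}m'E mdegD -/m.
  rewrite -{2}[mdeg m]addn0 leq_add2l leqn0 mdeg_eq0 => /eqP dm0.
  by rewrite m'E dm0 addm0 eqxx in nm'.
have lt_d : (m' i + (d - m i) < d)%N.
  by rewrite -[X in (_ < X)%N](subnKC (md i)) ltn_add2r.
rewrite (bigD1 i) //= mnmDE mnmE rem_Xn ?(ltnW lt_d) // coefXn.
by rewrite (gtn_eqF lt_d) mul0r scaler0.
Qed.

Lemma in_var_neq0 k : in_var k p != 0.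
Proof.
apply/eqP => /(congr1 (mcoeff (U_(k) *+ d.+1))%MM); rewrite mcoeff0 => /eqP.
rewrite -[p]coefK poly_def linear_sum raddf_sum p_size big_ord_recr /= big1 ?add0r.
  rewrite /= in_varZ in_varXn mcoeffZ mcoeffX eqxx mulr1.
  by rewrite -[d.+1]/(d.+2.-1) -p_size -/(lead_coef p) (monicP p_monic) oner_eq0.
move=> j _; rewrite /= in_varZ in_varXn mcoeffZ mcoeffX.
case: eqP => [/mnmP/(_ k)|]; last by rewrite mulr0.
by rewrite !mulmnE mnm1E eqxx !mul1n => jE; have := ltn_ord j; rewrite jE ltnn.
Qed.

(** For k outside [P], taking normal forms commutes with multiplication by p(x_k), a nonzero element
    of a domain. *)
Lemma seq_submod_regular (P : pred 'I_n) k (s : S^o) :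
  ~~ P k -> I P (in_var k p *: s) -> I P s.
Proof.
move=> nPk /reduce_eq0P; rewrite reduce_in_var_out // => /eqP.
by rewrite mulf_eq0 (negPf (in_var_neq0 k)) => /eqP/reduce_eq0P.
Qed.

End Reduction.

(** * A univariate polynomial p with every p(x_i) in the Jacobian ideal *)

Section JacobianPolynomial.

Variables (n : nat) (K : fieldType) (W : {mpoly K[n]}).
Local Notation J := (@jacobian_ideal n K W).

Lemma jacobian_idealD f g : J f -> J g -> J (f + g).
Proof.
move=> [u ->] [v ->]; exists (fun i => u i + v i).
by rewrite -big_split; apply: eq_bigr => i _; rewrite mulrDl.
Qed.

Lemma jacobian_idealM (a f : {mpoly K[n]}) : J f -> J (a * f).
Proof.
move=> [u ->]; exists (fun i => a * u i).
by rewrite mulr_sumr; apply: eq_bigr => i _; rewrite mulrA.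
Qed.

Lemma jacobian_ideal_sum (I : Type) (s : seq I) (F : I -> {mpoly K[n]}) :
  (forall i, J (F i)) -> J (\sum_(i <- s) F i).
Proof.
move=> JF; apply: (big_ind J) => //; last exact: jacobian_idealD.
by exists (fun=> 0); rewrite big1 // => i _; rewrite mul0r.
Qed.

(** The r + 1 powers 1, x_i, ..., x_i^r are linearly dependent in the r-dimensional Milnor ring. *)
Lemma jacobian_univariate i : milnor_finite_dim W ->
  exists2 q : {poly K}, q != 0 & J (in_var i q).
Proof.
move=> [r [e [_ gen _]]].
have /fin_all_exists[c Jc] (j : 'I_r.+1) :
    exists c : 'I_r -> K, J (in_var i 'X^j - klincomb c e) by exact: gen.
pose C := \matrix_(j < r.+1, k < r) c j k.
have /rowV0Pn[u /sub_kermxP uC u0] : kermx C != 0.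
  by rewrite kermx_eq0 -row_leq_rank -ltnNge ltnS rank_leq_col.
pose q := \poly_(j < r.+1) u 0 (inord j).
have qE : q = \sum_(j < r.+1) u 0 j *: 'X^j.
  by rewrite /q poly_def; apply: eq_bigr => j _; rewrite inord_val.
exists q.
  apply: contraNneq u0 => q0; apply/eqP/rowP => j; rewrite mxE.
  by have := coef0 K j; rewrite -q0 coef_poly ltn_ord inord_val.
have -> : in_var i q = \sum_j (u 0 j)%:MP * (in_var i 'X^j - klincomb (c j) e).
  rewrite qE linear_sum; apply/eqP; rewrite -subr_eq0 -sumrB; apply/eqP.
  transitivity (\sum_j (u 0 j)%:MP * klincomb (c j) e).
    apply: eq_bigr => j _; rewrite /= in_varZ -mul_mpolyC mulrBr opprB addrCA.
    by rewrite subrr addr0.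
  transitivity (\sum_j \sum_k (u 0 j * c j k)%:MP * e k).
    apply: eq_bigr => j _; rewrite mulr_sumr; apply: eq_bigr => k _.
    by rewrite mpolyCM mulrA.
  rewrite exchange_big big1 // => k _; rewrite -mulr_suml -rmorph_sum.
  have /rowP/(_ k) := uC; rewrite !mxE => uC0.
  rewrite (eq_bigr (fun j => u 0 j * C j k)) => [|j _]; last by rewrite mxE.
  by rewrite uC0 rmorph0 mul0r.
by apply: jacobian_ideal_sum => j; apply: jacobian_idealM.
Qed.

Lemma jacobian_common_polynomial : milnor_finite_dim W ->
  exists p : {poly K}, [/\ p \is monic, (1 < size p)%N & forall i, J (in_var i p)].
Proof.
move=> fin; have /fin_all_exists2[q q0 Jq] i := jacobian_univariate i fin.
(* The product serves all variables at once; the factor ['X] keeps the degree positive even if every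
   q_i is constant. *)
pose q' := 'X * \prod_i q i; have q'0 : q' != 0.
  by rewrite mulf_neq0 ?polyX_eq0 // prodf_seq_neq0; apply/allP => i _; apply: q0.
exists ((lead_coef q')^-1 *: q'); split.
- by rewrite monicE lead_coefZ mulVf // lead_coef_eq0.
- rewrite size_scale ?invr_eq0 ?lead_coef_eq0 // /q' mulrC.
  rewrite size_mulX ?ltnS ?size_poly_gt0 //.
    by rewrite prodf_seq_neq0; apply/allP => i _; apply: q0.
  by rewrite prodf_seq_neq0; apply/allP => i _; apply: q0.
move=> i; rewrite in_varZ -mul_mpolyC; apply: jacobian_idealM.
rewrite /q' (bigD1 i) //= mulrCA mulrC rmorphM /=; exact: jacobian_idealM.
Qed.

End JacobianPolynomial.

(** * Entrywise membership for matrices *)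

Section MatrixModule.

Variables (S : comNzRingType) (n : nat) (p : 'I_n -> S).
Local Notation I := (seq_submod p).

Lemma seq_submod_mx r s (P : pred 'I_n) (A : 'M[S]_(r, s)) :
  (forall i j, I P (A i j : S^o)) -> I P A.
Proof.
move=> IA; have /fin_all_exists[G GE] (ij : 'I_r * 'I_s) :
    exists g : 'I_n -> S, A ij.1 ij.2 = \sum_(l | P l) p l * g l.
  by have [g ->] := IA ij.1 ij.2; exists g.
exists (fun l => \matrix_(i, j) G (i, j) l); apply/matrixP => i j.
rewrite summxE (GE (i, j)); apply: eq_bigr => l _.
by rewrite !mxE.
Qed.

Lemma seq_submod_entry r s (P : pred 'I_n) (A : 'M[S]_(r, s)) i j :
  I P A -> I P (A i j : S^o).
Proof.
move=> [G ->]; exists (fun l => G l i j).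
by rewrite summxE; apply: eq_bigr => l _; rewrite mxE.
Qed.

End MatrixModule.

(** * The Z/2-grading on matrices *)

Section Parity.

Variables (S : comNzRingType) (r : nat) (par : 'I_r -> bool).

(** Here [par i] is the degree of the i-th basis vector. *)
Definition parity_homogeneous (e : bool) (F : 'M[S]_r) : Prop :=
  forall i j, par i (+) par j != e -> F i j = 0.

Local Notation hom := parity_homogeneous.

Definition parity_mx : 'M[S]_r := diag_mx (\row_i (-1) ^+ par i).
Local Notation sg := parity_mx.

Lemma parity_mxK : sg *m sg = 1%:M.
Proof.
rewrite /sg mul_diag_mx -diag_const_mx; apply/matrixP => i j; rewrite !mxE.
by rewrite mulrnAr -expr2 sqrr_sign.
Qed.

Definition parity_twist (F : 'M[S]_r) : 'M[S]_r := sg *m F *m sg.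
Local Notation gam := parity_twist.

Lemma parity_twist_linear : linear gam.
Proof.
by move=> a F G; rewrite /gam mulmxDr mulmxDl -scalemxAr -scalemxAl.
Qed.
HB.instance Definition _ := GRing.isLinear.Build S _ _ _ gam parity_twist_linear.

Lemma parity_twistK F : gam (gam F) = F.
Proof.
by rewrite /gam !mulmxA parity_mxK mul1mx -mulmxA parity_mxK mulmx1.
Qed.

Lemma parity_twistM F G : gam (F *m G) = gam F *m gam G.
Proof.
by rewrite /gam !mulmxA -[sg *m F *m sg *m sg]mulmxA parity_mxK mulmx1.
Qed.

Lemma parity_twist_homogeneous e F : hom e F -> gam F = (-1) ^+ e *: F.
Proof.
move=> hF; rewrite /gam /sg mul_diag_mx mul_mx_diag; apply/matrixP => i j.
rewrite !mxE mulrAC -signr_addb.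
have [-> // | /hF ->] := eqVneq (par i (+) par j) e.
by rewrite !mulr0.
Qed.

Definition parity_part (e : bool) (F : 'M[S]_r) : 'M[S]_r :=
  \matrix_(i, j) if par i (+) par j == e then F i j else 0.

Lemma parity_part_homogeneous e F : hom e (parity_part e F).
Proof. by move=> i j /negPf ije; rewrite mxE ije. Qed.

Lemma parity_part_id e F : hom e F -> parity_part e F = F.
Proof. by move=> hF; apply/matrixP => i j; rewrite mxE; case: eqVneq => [|/hF]. Qed.

Lemma parity_part_neg e F : hom e F -> parity_part (~~ e) F = 0.
Proof.
move=> hF; apply/matrixP => i j; rewrite !mxE; case: eqVneq => // ije.
by apply: hF; rewrite ije; case: (e).
Qed.

Lemma parity_partE F : F = parity_part false F + parity_part true F.
Proof.
by apply/matrixP => i j; rewrite !mxE; case: (_ (+) _); rewrite /= ?addr0 ?add0r.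
Qed.

Lemma parity_part_linear e : linear (parity_part e).
Proof.
by move=> a F G; apply/matrixP => i j; rewrite !mxE; case: ifP; rewrite ?mulr0 ?addr0.
Qed.
HB.instance Definition _ e :=
  GRing.isLinear.Build S _ _ _ (parity_part e) (parity_part_linear e).

Lemma homogeneousM e e' F G : hom e F -> hom e' G -> hom (e (+) e') (F *m G).
Proof.
move=> hF hG i j ije; rewrite mxE big1 // => k _.
have [ik | /hF ->] := eqVneq (par i (+) par k) e; last by rewrite mul0r.
rewrite hG ?mulr0 //; move: ije; rewrite -ik.
by apply: contraNneq => <-; case: (par i); case: (par j); case: (par k).
Qed.

End Parity.

(** * The endomorphism complex in matrix form and its residue pairing *)

Section MatrixFactorization.

Variables (n : nat) (K : fieldType) (p : {poly K}) (d : nat).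
Hypotheses (p_monic : p \is monic) (p_size : size p = d.+2).
Local Notation S := {mpoly K[n]}.
Local Notation I := (seq_submod (fun i : 'I_n => in_var i p)).
Variables (r : nat) (par : 'I_r -> bool).
Local Notation hom := (@parity_homogeneous S r par).
Local Notation sg := (parity_mx S par).
Local Notation gam := (@parity_twist S r par).
Local Notation parity_part := (@parity_part S r par).

Variables (W : S) (Q : 'M[S]_r).
Hypotheses (Q_odd : hom true Q) (Q_sqr : Q *m Q = W%:M).
Hypothesis jac : forall i : 'I_n, jacobian_ideal W (in_var i p).

Let gamQ : gam Q = - Q.
Proof. by rewrite (parity_twist_homogeneous Q_odd) expr1 scaleN1r. Qed.

(* The twist by gam replaces the sign (-1)^|F|, so that no parity is needed. The order
   of the products is reversed because matrices act on row vectors. *)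
Definition mx_differential (F : 'M[S]_r) : 'M[S]_r := F *m Q - Q *m gam F.
Local Notation dd := mx_differential.

Lemma mx_differential_linear : linear dd.
Proof.
move=> a F G; rewrite /dd linearP mulmxDl mulmxDr -scalemxAl -scalemxAr.
by rewrite scalerBr opprD addrACA.
Qed.
HB.instance Definition _ := GRing.isLinear.Build S _ _ _ dd mx_differential_linear.

(** The mixed terms cancel because [gam] negates [Q], the others because Q^2 = W is central. *)
Lemma mx_differential_sqr F : dd (dd F) = 0.
Proof.
rewrite /dd linearB /= [gam (F *m Q)]parity_twistM [gam (Q *m _)]parity_twistM.
rewrite gamQ parity_twistK mulNmx mulmxN opprK.
rewrite mulmxBl mulmxDr mulmxN opprD opprK addrA [Q *m (_ *m Q)]mulmxA subrK.
by rewrite -mulmxA Q_sqr mulmxA Q_sqr mul_scalar_mx mul_mx_scalar subrr.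
Qed.

Lemma mx_differential_twist F : dd (gam F) = - gam (dd F).
Proof.
rewrite /dd linearB /= [gam (F *m Q)]parity_twistM [gam (Q *m _)]parity_twistM.
rewrite gamQ parity_twistK mulNmx mulmxN.
by rewrite opprB opprK addrC.
Qed.

(** Allows cocycles and primitives to be replaced by their homogeneous parts. *)
Lemma mx_differential_part e F : dd (parity_part e F) = parity_part (~~ e) (dd F).
Proof.
have hd e' G : hom e' G -> hom (~~ e') (dd G).
  move=> hG; have h1 := homogeneousM hG Q_odd; have h2 := homogeneousM Q_odd hG.
  rewrite /dd (parity_twist_homogeneous hG) -scalemxAr => i j ij.
  rewrite addbT in h1; rewrite addTb in h2.
  have mxBZ (A B : 'M[S]_r) c : (A - c *: B) i j = A i j - c * B i j by rewrite !mxE.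
  by rewrite mxBZ h1 // h2 // mulr0 subr0.
have pe e' := parity_part_id (hd _ _ (@parity_part_homogeneous _ _ par e' F)).
have ne e' : parity_part e' (dd (parity_part e' F)) = 0.
  rewrite -{1}[e']negbK; apply: parity_part_neg.
  exact: hd (@parity_part_homogeneous _ _ par e' F).
have dF : dd F = dd (parity_part false F) + dd (parity_part true F).
  by rewrite {1}[F](parity_partE par) linearD.
rewrite dF [RHS]linearD; case: e.
  by rewrite [X in _ + X](pe true) [X in X + _](ne false) add0r.
by rewrite [X in X + _](pe false) [X in _ + X](ne true) addr0.
Qed.

Lemma mx_differential_homogeneous e F :
  hom e F -> dd F = F *m Q - (-1) ^+ e *: (Q *m F).
Proof. by move=> hF; rewrite /dd (parity_twist_homogeneous hF) scalemxAr. Qed.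

Lemma derivation_homogeneous k : hom true (map_mx (mderiv k) Q).
Proof. by move=> i j ij; rewrite mxE Q_odd // linear0. Qed.

Lemma derivation_anticommutator k :
  map_mx (mderiv k) Q *m Q + Q *m map_mx (mderiv k) Q = (mderiv k W)%:M.
Proof.
apply/matrixP => i j; have /matrixP/(_ i j)/(congr1 (mderiv k)) := Q_sqr.
rewrite !mxE linear_sum linearMn /= => <-; rewrite -big_split; apply: eq_bigr => l _.
by rewrite !mxE mderivM.
Qed.

Lemma jacobian_homotopy i :
  exists2 L : 'M[S]_r, hom true L & L *m Q + Q *m L = (in_var i p)%:M.
Proof.
have [g ->] := jac i.
exists (\sum_k g k *: map_mx (mderiv k) Q).
  move=> j l jl; rewrite summxE big1 // => k _.
  by rewrite mxE derivation_homogeneous // mulr0.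
rewrite mulmx_suml mulmx_sumr -big_split raddf_sum; apply: eq_bigr => k _ /=.
by rewrite -scalemxAl -scalemxAr -scalerDr derivation_anticommutator scale_scalar_mx.
Qed.

Section Pairing.

Variable L : 'I_n -> 'M[S]_r.
Hypotheses (L_odd : forall i, hom true (L i))
  (L_homotopy : forall i, L i *m Q + Q *m L i = (in_var i p)%:M).

(** As matrices act on row vectors, right multiplication by [L i] is composition with lambda_i on
    the left. *)
Definition mx_homotopy i (F : 'M[S]_r) : 'M[S]_r := F *m L i.
HB.instance Definition _ i := GRing.Linear.copy (mx_homotopy i) (mulmxr (L i)).

Lemma mx_homotopyP i F :
  dd (mx_homotopy i F) + mx_homotopy i (dd F) = in_var i p *: F.
Proof.
rewrite /dd /mx_homotopy parity_twistM (parity_twist_homogeneous (@L_odd i)).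
rewrite expr1 scaleN1r !mulmxN opprK mulmxBl -!mulmxA addrACA subrr addr0.
by rewrite -mulmxDr L_homotopy mul_mx_scalar.
Qed.

(* sg makes this a supertrace. *)
Definition trace_pairing (F : 'M[S]_r) (G : 'M[S]_r) : S^o := \tr (sg *m F *m G).
Local Notation B := trace_pairing.

Lemma trace_pairing_linearr F : linear (B F).
Proof. by move=> a G H; rewrite /B linearP /= linearP. Qed.
HB.instance Definition _ F :=
  GRing.isLinear.Build S _ S^o _ (B F) (trace_pairing_linearr F).

Lemma trace_pairing_linearl a F F' G : B (a *: F + F') G = a * B F G + B F' G.
Proof. by rewrite /B linearP /= mulmxDl -scalemxAl linearP. Qed.

(** The two terms on each side match by cyclicity of the trace, since [sg] anticommutes with the odd
    matrix [Q]. *)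
Lemma trace_pairing_differential F G : B (dd F) G = B (gam F) (dd G).
Proof.
have sQ : sg *m Q = - Q *m sg.
  by rewrite -gamQ /gam -!mulmxA parity_mxK mulmx1.
have t1 : \tr (sg *m gam F *m (G *m Q)) = - \tr (sg *m (Q *m gam F) *m G).
  move: (gam F) => A.
  by rewrite mulmxA mxtrace_mulC !mulmxA sQ !mulNmx raddfN opprK.
have t2 : \tr (sg *m gam F *m (Q *m gam G)) = - \tr (sg *m (F *m Q) *m G).
  rewrite /gam !mulmxA parity_mxK mul1mx -(mulmxA F) sQ mulNmx mulmxN !mulNmx raddfN.
  congr (- _); rewrite [LHS]mxtrace_mulC !mulmxA; congr (\tr (_ *m _)).
  by rewrite -mulmxA parity_mxK mulmx1.
rewrite /B /dd; move: (gam F) (gam G) t1 t2 => F' G' t1 t2.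
rewrite [sg *m (_ - _)]mulmxBr [(_ - _) *m G]mulmxBl [sg *m F' *m _]mulmxBr.
by rewrite [LHS]raddfB [RHS]raddfB /= t1 t2 opprK addrC.
Qed.

Local Notation res := (residue p d).
Local Notation nu := (homotopies mx_homotopy (enum 'I_n)).

Lemma trace_mul_delta (A : 'M[S]_r) i j y : \tr (A *m (y *: delta_mx j i)) = A i j * y.
Proof.
rewrite -scalemxAr mxtraceZ mulrC; congr (_ * _); rewrite /mxtrace (bigD1 i) //=.
rewrite big1 ?addr0 => [|k /negPf ki]; rewrite mxE (bigD1 j) //= big1 ?addr0.
- by rewrite mxE !eqxx mulr1.
- by move=> l /negPf lj; rewrite mxE lj mulr0.
- by rewrite mxE ki andbF mulr0.
by move=> l /negPf lj; rewrite mxE lj mulr0.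
Qed.

(** Multiples of elementary matrices, with a sign undoing [sg], isolate each entry and reduce the
    claim to nondegeneracy of the residue. *)
Lemma trace_pairing_nondegeneratel F :
  (forall G, res (B F G) = 0) -> I xpredT F.
Proof.
move=> F0; apply: seq_submod_mx => i j.
apply: (residue_nondegenerate p_monic p_size) => y.
rewrite -(F0 (((-1) ^+ par i * y) *: delta_mx j i)) /B trace_mul_delta.
rewrite /sg mul_diag_mx !mxE; congr (res _).
by rewrite mulrACA -expr2 sqrr_sign mul1r.
Qed.

Lemma trace_pairing_nondegenerater F :
  (forall G, res (B G F) = 0) -> I xpredT F.
Proof.
move=> F0; apply: seq_submod_mx => i j.
apply: (residue_nondegenerate p_monic p_size) => y.
rewrite -(F0 (((-1) ^+ par j * y) *: delta_mx j i)) /B mxtrace_mulC mulmxA.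
rewrite trace_mul_delta /sg mul_mx_diag !mxE; congr (res _).
by rewrite mulrA -[_ * _ * _ ^+ _]mulrA -expr2 sqrr_sign mulr1.
Qed.

Lemma seq_submod_mx_regular (P : pred 'I_n) k (F : 'M[S]_r) :
  ~~ P k -> I P (in_var k p *: F) -> I P F.
Proof.
move=> nPk IF; apply: seq_submod_mx => i j.
apply: (seq_submod_regular p_monic p_size nPk).
by have := seq_submod_entry i j IF; rewrite mxE.
Qed.

Definition box_mx (t : {ffun 'I_n -> 'I_d.+1} * ('I_r * 'I_r)) : 'M[S]_r :=
  'X_[box t.1] *: delta_mx t.2.1 t.2.2.

Lemma box_mx_span F : exists c, I xpredT (F - \sum_t (c t)%:MP_[n] *: box_mx t).
Proof.
exists (fun t => (reduce p xpredT (F t.2.1 t.2.2))@_(box t.1)).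
have -> : \sum_t ((reduce p xpredT (F t.2.1 t.2.2))@_(box t.1))%:MP_[n] *: box_mx t =
          map_mx (reduce p xpredT) F.
  rewrite [RHS]matrix_sum_delta pair_bigA /=.
  rewrite -(pair_bigA _ (fun f ij => ((reduce p xpredT (F ij.1 ij.2))@_(box f))%:MP_[n] *:
    box_mx (f, ij))) exchange_big /=; apply: eq_bigr => [[i j]] _ /=.
  rewrite mxE [reduce p _ (F i j)](reduce_box p_monic p_size) scaler_suml.
  by apply: eq_bigr => f _; rewrite /box_mx scalerA mul_mpolyC -(reduce_box p_monic p_size).
by apply: seq_submod_mx => i j; rewrite !mxE; apply: sub_reduce.
Qed.

Lemma res_mpolyC a (s : S) : res (a%:MP * s) = a * res s.
Proof. by rewrite mul_mpolyC residueZ. Qed.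

(** The Kapustin-Li type pairing in matrix form. *)
Definition residue_pairing (F G : 'M[S]_r) : K := res (B F (nu G)).

Lemma residue_pairing_linearl c F F' G :
  residue_pairing (c%:MP *: F + F') G = c * residue_pairing F G + residue_pairing F' G.
Proof.
rewrite /residue_pairing trace_pairing_linearl [LHS]raddfD; congr (_ + _).
exact: res_mpolyC.
Qed.

Lemma residue_pairing_linearr c F G G' :
  residue_pairing F (c%:MP *: G + G') = c * residue_pairing F G + residue_pairing F G'.
Proof.
rewrite /residue_pairing [nu _]linearP [B _ _]linearP [LHS]raddfD; congr (_ + _).
exact: res_mpolyC.
Qed.

Lemma mx_cocycle_pairing_nondegenerate F :
  dd F = 0 -> (forall G, dd G = 0 -> residue_pairing F G = 0) -> exists H, F = dd H.
Proof.
apply: (@cocycle_pairing_nondegenerate n S K (@mpolyC n K) _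
  (fun i => in_var i p) dd gam mx_homotopy B res
  _ _ _ _ _ _ _ _ _ _ _ _ box_mx box_mx_span).
- exact: seq_submod_mx_regular.
- exact: (seq_submod_regular p_monic p_size).
- exact: mx_differential_sqr.
- exact: mx_homotopyP.
- exact: parity_twistK.
- by move=> G a x x'; apply: trace_pairing_linearl.
- exact: trace_pairing_differential.
- exact: res_mpolyC.
- exact: residue_mem.
- exact: trace_pairing_nondegeneratel.
- exact: trace_pairing_nondegenerater.
Qed.

Lemma mx_cocycle_pairing_coboundary F H : dd F = 0 -> residue_pairing F (dd H) = 0.
Proof.
apply: (@cocycle_pairing_coboundary n S K _ (fun i => in_var i p) dd gam
  mx_homotopy B res).
- exact: mx_homotopyP.
- exact: parity_twistK.
- exact: mx_differential_twist.
- by move=> G a x x'; apply: trace_pairing_linearl.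
- exact: trace_pairing_differential.
- exact: residue_mem.
Qed.

(** The product is odd, so its diagonal vanishes. *)
Lemma trace_pairing_parity e F G : hom e F -> hom (~~ e) G -> B F G = 0.
Proof.
move=> hF hG; rewrite /B -mulmxA /mxtrace big1 // => i _; rewrite /sg mul_diag_mx mxE.
rewrite (homogeneousM hF hG) ?mulr0 //.
by rewrite addbb addbN addbb.
Qed.

(** Each of the n odd factors flips the parity; this is how the parity of n enters. *)
Lemma nu_homogeneous e G : hom e G -> hom (e (+) odd n) (nu G).
Proof.
move=> hG; rewrite -[n in odd n](size_enum_ord n).
elim: (enum 'I_n) => [|i s IH] /=; first by rewrite addbF.
by rewrite -[~~ _]addTb addbCA addbC; apply: homogeneousM.
Qed.

(** F pairs to zero with cocycles of the other parity anyway, so testing degree e + n suffices; the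
    primitive is then cut down to its part of degree e + 1. *)
Lemma mx_cohomology_pairing_nondegenerate e F :
    hom e F -> dd F = 0 ->
    (forall G, hom (e (+) odd n) G -> dd G = 0 -> residue_pairing F G = 0) ->
  exists2 H, hom (~~ e) H & F = dd H.
Proof.
move=> hF dF0 F0; have [|H FH] := mx_cocycle_pairing_nondegenerate dF0; last first.
  exists (parity_part (~~ e) H); first exact: parity_part_homogeneous.
  by rewrite mx_differential_part negbK -FH parity_part_id.
move=> G dG0; have part0 e' : dd (parity_part e' G) = 0.
  by rewrite mx_differential_part dG0 linear0.
suff res0 e' : residue_pairing F (parity_part e' G) = 0.
  rewrite [G](parity_partE par) /residue_pairing [nu _]raddfD [B _ _]raddfD [LHS]raddfD.
  by rewrite [X in X + _]res0 [X in _ + X]res0 addr0.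
have [->|ne'] := eqVneq e' (e (+) odd n).
  exact: (F0 _ (@parity_part_homogeneous _ _ _ _ _) (part0 _)).
have hnu := nu_homogeneous (@parity_part_homogeneous _ _ par e' G).
have e'E : e' (+) odd n = ~~ e.
  by case: (e) (e') (odd n) ne' => [] [] [].
rewrite e'E in hnu.
rewrite /residue_pairing (trace_pairing_parity hF hnu); exact: raddf0.
Qed.

End Pairing.

End MatrixFactorization.

(** Hides the choice of p and of the homotopies, leaving only the formal properties that the
    dimension count uses. *)
Lemma mx_cohomology_pairing (n : nat) (K : fieldType) (W : {mpoly K[n]}) (r : nat)
    (par : 'I_r -> bool) (Q : 'M[{mpoly K[n]}]_r) :
    milnor_finite_dim W -> parity_homogeneous par true Q -> Q *m Q = W%:M ->
  exists phi : 'M[{mpoly K[n]}]_r -> 'M[{mpoly K[n]}]_r -> K,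
  [/\ forall c F F' G, phi (c%:MP *: F + F') G = c * phi F G + phi F' G,
      forall c F G G', phi F (c%:MP *: G + G') = c * phi F G + phi F G',
      forall F H, mx_differential par Q F = 0 -> phi F (mx_differential par Q H) = 0 &
      forall e F, parity_homogeneous par e F -> mx_differential par Q F = 0 ->
        (forall G, parity_homogeneous par (e (+) odd n) G ->
           mx_differential par Q G = 0 -> phi F G = 0) ->
        exists2 H, parity_homogeneous par (~~ e) H & F = mx_differential par Q H].
Proof.
move=> milnorW Q_odd Q_sqr.
have [p [p_monic p_size jac]] := jacobian_common_polynomial milnorW.
have {}p_size : size p = (size p).-2.+2 by case: (size p) p_size => [|[]].
have /fin_all_exists2[L L_odd L_homotopy] := jacobian_homotopy Q_odd Q_sqr jac.
exists (residue_pairing p (size p).-2 par L); split.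
- exact: residue_pairing_linearl.
- exact: residue_pairing_linearr.
- exact: (mx_cocycle_pairing_coboundary _ Q_odd L_odd L_homotopy).
exact: (mx_cohomology_pairing_nondegenerate p_monic p_size Q_odd Q_sqr
  L_odd L_homotopy).
Qed.

(** If b < a, the a by b Gram matrix has a nonzero left kernel vector; the corresponding combination
    of [e1] is orthogonal to [Z2], hence lies in [B1], against independence. *)
Lemma quot_dim_le_pairing (n : nat) (K : fieldType) (V : lmodType {mpoly K[n]})
    (Z1 B1 Z2 B2 : V -> Prop) (a b : nat) (phi : V -> V -> K) :
    (forall (c : K) x x' y, phi (c%:MP_[n] *: x + x') y = c * phi x y + phi x' y) ->
    (forall (c : K) x y y', phi x (c%:MP_[n] *: y + y') = c * phi x y + phi x y') ->
    (forall (d : nat) (c : 'I_d -> K) e, (forall i, Z1 (e i)) -> Z1 (klincomb c e)) ->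
    (forall x y, Z1 x -> B2 y -> phi x y = 0) ->
    (forall x, Z1 x -> (forall y, Z2 y -> phi x y = 0) -> B1 x) ->
  quot_has_dim Z1 B1 a -> quot_has_dim Z2 B2 b -> (a <= b)%N.
Proof.
move=> phil phir Z1lin phiB nondeg [e1 [Ze1 _ ind1]] [e2 [_ gen2 _]].
have phi0l y : phi 0 y = 0.
  by have := phil (-1) 0 0 y; rewrite scaler0 addr0 mulN1r addNr.
have phi0r x : phi x 0 = 0.
  by have := phir (-1) x 0 0; rewrite scaler0 addr0 mulN1r addNr.
have lincombl d (c : 'I_d -> K) e y : phi (klincomb c e) y = \sum_i c i * phi (e i) y.
  rewrite /klincomb; apply: (big_rec2 (fun x s => phi x y = s)) => //= i s x _ <-.
  exact: phil.
have lincombr d (c : 'I_d -> K) e x : phi x (klincomb c e) = \sum_i c i * phi x (e i).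
  rewrite /klincomb; apply: (big_rec2 (fun y s => phi x y = s)) => //= i s y _ <-.
  exact: phir.
rewrite leqNgt; apply/negP => lt_ba.
pose P := \matrix_(i < a, j < b) phi (e1 i) (e2 j).
have /rowV0Pn[u /sub_kermxP uP u0] : kermx P != 0.
  by rewrite kermx_eq0 -row_leq_rank -ltnNge (leq_ltn_trans (rank_leq_col _)).
case/eqP: u0; apply/rowP => i; rewrite mxE; apply: (ind1 (u 0)); apply: nondeg.
  exact: Z1lin.
move=> y /gen2[c By]; set x := klincomb _ _.
(* The scalar 1 gives the decomposition the shape required by [phir]; the difference lies in [B2]
   and pairs to zero. *)
have -> : y = 1%:MP_[n] *: (y - klincomb c e2) + klincomb c e2.
  by rewrite mpolyC1 scale1r subrK.
rewrite phir phiB ?mulr0 ?add0r //; last exact: Z1lin.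
rewrite lincombr big1 // => j _; rewrite /x lincombl.
have /rowP/(_ j) := uP; rewrite !mxE => uPj.
rewrite (eq_bigr (fun k => u 0 k * P k j)) ?uPj ?mulr0 // => k _.
by rewrite mxE.
Qed.

(** * Translation between graded endomorphisms and matrices *)

Section EndomorphismMatrix.

Import VectorInternalTheory.

Variables (S : comNzRingType) (R0 R1 : vectType S).
Local Notation V := (R0 * R1)%type.
Local Notation r := (dim R0 + dim R1)%N.

Definition coord_row (x : V) : 'rV[S]_r := row_mx (v2r x.1) (v2r x.2).
Definition row_coord (u : 'rV[S]_r) : V := (r2v (lsubmx u), r2v (rsubmx u)).

Lemma coord_row_linear : linear coord_row.
Proof. by move=> a x y; rewrite /coord_row !linearP -add_row_mx -scale_row_mx. Qed.
HB.instance Definition _ := GRing.isLinear.Build S V _ _ coord_row coord_row_linear.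

Lemma row_coord_linear : linear row_coord.
Proof. by move=> a u v; rewrite /row_coord !linearP. Qed.
HB.instance Definition _ := GRing.isLinear.Build S _ V _ row_coord row_coord_linear.

Lemma coord_rowK : cancel coord_row row_coord.
Proof. by case=> x y; rewrite /row_coord row_mxKl row_mxKr !v2rK. Qed.

Lemma row_coordK : cancel row_coord coord_row.
Proof. by move=> u; rewrite /coord_row /= !r2vK hsubmxK. Qed.

Definition end_mx (f : 'End(V)) : 'M[S]_r := lin1_mx (coord_row \o f \o row_coord).

Lemma mul_end_mx f u : u *m end_mx f = coord_row (f (row_coord u)).
Proof. exact: mul_rV_lin1. Qed.

Definition mx_end (A : 'M[S]_r) : 'End(V) :=
  linfun (row_coord \o mulmxr A \o coord_row).

Lemma mulmx_ext (A A' : 'M[S]_r) : (forall u : 'rV_r, u *m A = u *m A') -> A = A'.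
Proof. by move=> AA'; apply/row_matrixP => i; rewrite !rowE. Qed.

Lemma mx_endK : cancel mx_end end_mx.
Proof. by move=> A; apply: mulmx_ext => u; rewrite mul_end_mx lfunE /= !row_coordK. Qed.

Lemma end_mxK : cancel end_mx mx_end.
Proof.
move=> f; apply/lfunP => x; rewrite lfunE /=.
by rewrite mul_end_mx !coord_rowK.
Qed.

Lemma end_mx_linear : linear end_mx.
Proof.
move=> a f g; apply: mulmx_ext => u.
by rewrite mulmxDr -scalemxAr !mul_end_mx add_lfunE scale_lfunE linearP.
Qed.
HB.instance Definition _ := GRing.isLinear.Build S _ _ _ end_mx end_mx_linear.

Lemma end_mx_comp f g : end_mx (f \o g)%VF = end_mx g *m end_mx f.
Proof.
by apply: mulmx_ext => u; rewrite mulmxA !mul_end_mx coord_rowK comp_lfunE.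
Qed.

Lemma end_mx1 : end_mx \1%VF = 1%:M.
Proof. by apply: mulmx_ext => u; rewrite mul_end_mx id_lfunE row_coordK mulmx1. Qed.

Lemma end_mx_commutator f g (a : S) :
  end_mx ((g \o f)%VF - a *: (f \o g)%VF) =
  end_mx f *m end_mx g - a *: (end_mx g *m end_mx f).
Proof. by rewrite linearB linearZ /= !end_mx_comp. Qed.

Lemma end_mx_sum (I : Type) (s : seq I) (a : I -> S) (f : I -> 'End(V)) :
  end_mx (\sum_(i <- s) a i *: f i) = \sum_(i <- s) a i *: end_mx (f i).
Proof. by rewrite linear_sum; apply: eq_bigr => i _; rewrite linearZ. Qed.

Definition coord_parity (i : 'I_r) : bool := (dim R0 <= i)%N.

Lemma graded_partP b x :
  graded_part b x <-> forall i, coord_parity i != b -> coord_row x 0 i = 0.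
Proof.
rewrite /graded_part /coord_parity; split.
  move=> xb i; rewrite -[i]splitK mxE unsplitK.
  case: (split i) => j /=.
    rewrite leqNgt ltn_ord /=; case: b xb => //= -> _.
    by rewrite linear0 mxE.
  rewrite leq_addr; case: b xb => //= -> _.
  by rewrite linear0 mxE.
case: b => x0; apply: (can_inj v2rK); rewrite linear0; apply/rowP => j; rewrite [RHS]mxE.
  have := x0 (lshift _ j); rewrite row_mxEl => -> //.
  by rewrite /= leqNgt ltn_ord.
by have := x0 (rshift _ j); rewrite row_mxEr => -> //; rewrite /= leq_addr.
Qed.

Lemma homogeneous_ofP e (f : 'End(V)) :
  homogeneous_of e f <-> parity_homogeneous coord_parity e (end_mx f).
Proof.
split=> [hf i j ij | hf b x /graded_partP xb].
  have -> : end_mx f i j = ((delta_mx 0 i : 'rV_r) *m end_mx f) 0 j.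
    by have /(congr1 (fun u : 'rV_r => u 0 j)) <- := rowE i (end_mx f); rewrite [RHS]mxE.
  rewrite mul_end_mx.
  have /graded_partP :
      graded_part (coord_parity i (+) e) (f (row_coord (delta_mx 0 i))).
    apply: hf; apply/graded_partP => k ki; rewrite row_coordK mxE.
    by case: (eqVneq k i) ki => [->|_ _]; rewrite ?eqxx ?andbF.
  by apply; apply: contraNneq ij => ->; rewrite addKb.
apply/graded_partP => j jb; rewrite -[x]coord_rowK -mul_end_mx mxE big1 // => i _.
have [ib | /xb ->] := eqVneq (coord_parity i) b; last by rewrite mul0r.
rewrite hf ?mulr0 // ib; apply: contraNneq jb => <-.
by rewrite addKb.
Qed.

End EndomorphismMatrix.

(** * Transfer of the pairing to the cohomology of End(R) and conclusion *)

Section CohomologyMatrix.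

Variables (n : nat) (K : fieldType) (W : {mpoly K[n]}) (R : matrix_factorization W).
Local Notation S := {mpoly K[n]}.
Local Notation par := (@coord_parity S (mf_even R) (mf_odd R)).
Local Notation mx := (@end_mx S (mf_even R) (mf_odd R)).
Local Notation dm := (mx_differential par (mx (mf_d R))).

(** On matrices of degree e the twist in [mx_differential] is the sign (-1)^e of
    [end_differential]. *)
Lemma end_mx_differential e (f : 'End(mf_module R)) :
  parity_homogeneous par e (mx f) -> mx (end_differential e f) = dm (mx f).
Proof.
move=> hf; rewrite (mx_differential_homogeneous _ hf).
exact: end_mx_commutator.
Qed.

Lemma end_cocycle_mxP e (f : 'End(mf_module R)) :
  end_cocycle e f <-> parity_homogeneous par e (mx f) /\ dm (mx f) = 0.
Proof.
split=> [[/homogeneous_ofP hf df] | [hf df]].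
  by split=> //; rewrite -(end_mx_differential hf) df [LHS]raddf0.
split; first exact/homogeneous_ofP.
apply: (can_inj (@end_mxK _ _ _)).
by rewrite [LHS](end_mx_differential hf) df [RHS]raddf0.
Qed.

Lemma end_cocycle_klincomb e (d : nat) (c : 'I_d -> K) (f : 'I_d -> 'End(mf_module R)) :
  (forall i, end_cocycle e (f i)) -> end_cocycle e (klincomb c f).
Proof.
move=> cf; apply/end_cocycle_mxP; rewrite [mx _]end_mx_sum; split.
  move=> j k jk; rewrite summxE big1 // => i _.
  by have /end_cocycle_mxP[hf _] := cf i; rewrite mxE hf // mulr0.
rewrite linear_sum big1 // => i _; have /end_cocycle_mxP[_ df] := cf i.
by rewrite linearZ /= df scaler0.
Qed.

(** For odd n the dual degree e + n is [~~ e]. The absence of a left kernel gives one inequality,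
    and applying this to both values of [e] gives equality. *)
Lemma End_cohomology_dim_le e (a b : nat) :
    odd n -> milnor_finite_dim W ->
    quot_has_dim (end_cocycle (R := R) e) (end_coboundary e) a ->
    quot_has_dim (end_cocycle (R := R) (~~ e)) (end_coboundary (~~ e)) b ->
  (a <= b)%N.
Proof.
move=> n_odd milnorW.
have Q_odd : parity_homogeneous par true (mx (mf_d R)).
  by apply/homogeneous_ofP/mf_d_odd.
have Q_sqr : mx (mf_d R) *m mx (mf_d R) = W%:M.
  by rewrite -end_mx_comp mf_d_sqr linearZ /= end_mx1 scalemx1.
have [phi [phil phir phiB nondeg]] := mx_cohomology_pairing milnorW Q_odd Q_sqr.
have {nondeg} := nondeg e; rewrite n_odd addbT => nondeg.
apply: (@quot_dim_le_pairing _ _ _ _ _ _ _ _ _ (fun f g => phi (mx f) (mx g))).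
- by move=> c x x' y; rewrite [mx _]linearP phil.
- by move=> c x y y'; rewrite [mx (_ + _)]linearP phir.
- exact: end_cocycle_klincomb.
- move=> x y /end_cocycle_mxP[_ dx] [g /homogeneous_ofP hg ->].
  by rewrite (end_mx_differential hg) phiB.
move=> x /end_cocycle_mxP[hx dx] x0.
have [|H hH xH] := nondeg _ hx dx.
  move=> G hG dG; rewrite -[G]mx_endK; apply: x0.
  by apply/end_cocycle_mxP; rewrite mx_endK.
have hH' : parity_homogeneous par (~~ e) (mx (mx_end H)) by rewrite mx_endK.
exists (mx_end H); first exact/homogeneous_ofP.
apply: (can_inj (@end_mxK _ _ _)).
by rewrite [RHS](end_mx_differential hH') mx_endK.
Qed.

End CohomologyMatrix.

Theorem theorem4p2 (n : nat) (K : closedFieldType) (W : {mpoly K[n]})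
    (R : matrix_factorization W) (n_odd : odd n)
    (milnorW : milnor_finite_dim W) (endR : End_finite_dim R) :
  chi_End R = 0.
Proof.
(* [End_dim] is picked by [epsilon]; finite-dimensionality ensures that the value picked is a
   genuine dimension. *)
have dimP e : quot_has_dim (end_cocycle (R := R) e) (end_coboundary e) (End_dim R e).
  exact: epsilon_spec (endR e).
apply/eqP; rewrite /chi_End subr_eq0 eqz_nat eqn_leq; apply/andP; split.
  exact: End_cohomology_dim_le n_odd milnorW (dimP false) (dimP true).
exact: End_cohomology_dim_le n_odd milnorW (dimP true) (dimP false).
Qed.
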